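(* Let $r,s,\alpha$ be integers with $0\le r\le s$ and $\alpha\ge 1$, let $a,b\in\mathbb{C}$ with $ab\neq 0$, and let $F=ax^ry^{s+\alpha}+bx^{r+\alpha}y^s\in\mathbb{C}[x,y]$, a binary binomial form of degree $d=r+s+\alpha$. Let $q,j$ be the unique nonnegative integers such that $r=q\alpha+j$ with $0\le j<\alpha$, and set $\delta=r+\alpha-s$. Then the Waring rank $\operatorname{rk}(F)$ of $F$ is given as follows. (1) If $\delta\le 0$, then $\operatorname{rk}(F)=s+1$. (2) If $\delta>0$, then $$\operatorname{rk}(F)=\begin{cases} s+2 & \text{if } j=0,\ r=s \text{ and } \alpha>1,\\ s+1 & \text{if } j=\delta,\\ r+\alpha+1 & \text{if } j>\delta,\\ r+\alpha-j & \text{otherwise.}\end{cases}$$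
   Context: A form is a homogeneous polynomial. For a form $F\in\mathbb{C}[x,y]$ of degree $d$, the Waring rank $\operatorname{rk}(F)$ is the least integer $m$ such that there exist linear forms $L_1,\dots,L_m\in\mathbb{C}[x,y]$ (homogeneous of degree 1) and scalars $c_1,\dots,c_m\in\mathbb{C}$ with $F=c_1L_1^d+\dots+c_mL_m^d$. *)

(* Defs.v *)
From mathcomp Require Import all_boot all_order all_algebra.
From mathcomp Require Import reals complex mpoly.

Set Implicit Arguments.
Unset Strict Implicit.
Unset Printing Implicit Defensive.

Import GRing.Theory.
Local Open Scope ring_scope.
Local Open Scope complex_scope.

(* The polynomial ring CC[x, y] is {mpoly R[i][2]}, where R : realType is the
   field of real numbers (unique up to isomorphism) and R[i] its complexification.
   Linear forms are the 1-homogeneous polynomials; the zero form is included. *)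

Definition waring_decomposable (R : realType) (d : nat)
    (F : {mpoly R[i][2]}) (m : nat) : Prop :=
  exists (c : 'I_m -> R[i]) (L : 'I_m -> {mpoly R[i][2]}),
    (forall k, L k \is 1.-homog) /\ F = \sum_(k < m) c k *: L k ^+ d.

(* d is the degree of the form F; decomposability already forces F to be
   d-homogeneous. *)
Definition is_waring_rank (R : realType) (d : nat)
    (F : {mpoly R[i][2]}) (m : nat) : Prop :=
  waring_decomposable d F m /\
  forall m', waring_decomposable d F m' -> (m <= m')%N.

Definition binomial_form (R : realType) (a b : R[i]) (r s alpha : nat) :
    {mpoly R[i][2]} :=
  let x := 'X_(0 : 'I_2) in
  let y := 'X_(1 : 'I_2) in
  a *: (x ^+ r * y ^+ (s + alpha)) + b *: (x ^+ (r + alpha) * y ^+ s).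

(* Main.v *)
Require Import Defs.
From mathcomp Require Import all_boot all_order all_algebra all_field.
From mathcomp Require Import reals complex mpoly.
From mathcomp Require Import zify ring.

Set Implicit Arguments.
Unset Strict Implicit.
Unset Printing Implicit Defensive.

Import GRing.Theory.
Local Open Scope ring_scope.
Local Open Scope complex_scope.

(* Sylvester's apolarity method. Write [F] as the sum over [n] of
   [C(d, n) f_n x^n y^(d - n)]. A decomposition of [F] into [m] powers
   [(u_k x + v_k y)^d] means [f_n = sum_k c_k u_k^n v_k^(d - n)], and such a
   decomposition with pairwise independent linear forms exists iff some
   squarefree binary form of degree [m] annihilates [f]. For a binomial only
   [f_r] and [f_(r + alpha)] are nonzero, so the annihilation equations relate
   only coefficients whose indices differ by [alpha]. Below the claimed rank they
   force two consecutive coefficients at one end of the form to vanish, hence a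
   square factor; at the claimed rank a geometric sum in [x^alpha], possibly
   multiplied by [x] or perturbed by a multiple of [x^m], is squarefree. *)

(** * Power sums and apolar polynomials *)

(* [P] is the dehomogenization of a binary form of degree [m]; a drop of its
   degree below [m] is a root of the form at infinity. *)
Definition apolar (K : fieldType) (d : nat) (f : nat -> K) (m : nat)
    (P : {poly K}) : Prop :=
  forall k, (k + m <= d)%N -> \sum_(i < m.+1) P`_i * f (i + k)%N = 0.

Definition power_sums (K : fieldType) (d : nat) (f : nat -> K) (m : nat) :
    Prop :=
  exists c u v : 'I_m -> K, forall n, (n <= d)%N ->
    f n = \sum_k c k * (u k ^+ n * v k ^+ (d - n)).

(** The ratios [u k / v k] with [v k != 0], taken once each, are the roots of [P]. All indices with
    [v k = 0] count together as one root at infinity, which raises [n] by one and leaves [P]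
    unchanged. *)
Lemma power_sums_apolar (K : fieldType) (d : nat) (f : nat -> K) (m : nat) :
  power_sums d f m ->
  exists n (P : {poly K}), [/\ (n <= m)%N, (n <= size P <= n.+1)%N,
    separable_poly P & apolar d f n P].
Proof.
move=> [c [u [v fE]]].
pose Z := undup [seq u k / v k | k <- enum 'I_m & v k != 0].
pose e := [exists k, v k == 0].
pose P : {poly K} := \prod_(z <- Z) ('X - z%:P).
have sP : size P = (size Z).+1 by rewrite size_prod_XsubC.
exists (size Z + e)%N, P; split.
- rewrite -[leqRHS](size_enum_ord m) -(count_predC (fun k => v k != 0)).
  apply: leq_add.
    by rewrite (leq_trans (size_undup _)) // size_map size_filter.
  rewrite /e; case: existsP => //= -[k vk0]; rewrite -has_count.
  by apply/hasP; exists k; rewrite ?mem_enum //= negbK.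
- by rewrite sP; case: e; lia.
- by rewrite separable_prod_XsubC undup_uniq.
move=> k le_kd.
transitivity (\sum_(i < (size Z + e).+1) \sum_j
    c j * (P`_i * (u j ^+ (i + k) * v j ^+ (d - (i + k))))).
  apply: eq_bigr => i _; rewrite fE; last by have := ltn_ord i; lia.
  by rewrite mulr_sumr; apply: eq_bigr => j _; rewrite mulrCA.
rewrite exchange_big big1 //= => j _; rewrite -mulr_sumr.
have [vj0|vj0] := eqVneq (v j) 0.
  have e1 : nat_of_bool e = 1%N.
    by apply/eqP; rewrite eqb1; apply/existsP; exists j; rewrite vj0.
  (* For [i <= size Z] the exponent of [v j] is positive, since [k + size Z + 1 <= d]; at the last
     index the coefficient of [P] is zero. *)
  rewrite big1 ?mulr0 // => i _.
  have [le_iZ|lt_Zi] := leqP i (size Z); last by rewrite nth_default ?mul0r ?sP.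
  rewrite vj0 expr0n (_ : (_ == 0)%N = false) ?mulr0 //.
  by lia.
have root_P : P.[u j / v j] = 0.
  apply/rootP; rewrite root_prod_XsubC mem_undup.
  by apply/mapP; exists j; rewrite // mem_filter vj0 mem_enum.
(* Factoring out [u j ^+ k * v j ^+ (d - k)] leaves the value of [P] at [u j / v j]. *)
transitivity (c j * (u j ^+ k * v j ^+ (d - k) * P.[u j / v j])); last first.
  by rewrite root_P !mulr0.
congr (_ * _); rewrite (@horner_coef_wide _ (size Z + e).+1) ?sP; last by lia.
rewrite mulr_sumr; apply: eq_bigr => i _.
have le_ikd : (i + k <= d)%N.
  by rewrite (leq_trans _ le_kd) // addnC leq_add2l -ltnS.
have -> : (d - k = d - (i + k) + i)%N by lia.
rewrite !exprD expr_div_n; field.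
by rewrite expf_neq0.
Qed.

(* The nodes are the roots of [P]; the moments [f n] with [n < size s] determine
   the weights through a Vandermonde system and [P], read as a linear recurrence,
   propagates the formula to the remaining moments. *)
Lemma apolar_interpolation (K : fieldType) (D : nat) (f : nat -> K)
    (s : seq K) (P : {poly K}) :
  uniq s -> size P = (size s).+1 -> all (root P) s ->
  (forall k, (k + size s < D)%N ->
     \sum_(i < (size s).+1) P`_i * f (i + k)%N = 0) ->
  exists c : 'I_(size s) -> K,
    forall n, (n < D)%N -> f n = \sum_k c k * s`_k ^+ n.
Proof.
move=> s_uniq sP rootP rec_f; set p := size s in sP rec_f *.
pose a : 'rV[K]_p := \row_j s`_j.
have V_unit : Vandermonde p a \in unitmx.
  rewrite unitmxE det_Vandermonde unitfE; apply/prodf_neq0 => i _.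
  apply/prodf_neq0 => j lt_ij; rewrite !mxE subr_eq0 nth_uniq //.
  by rewrite neq_ltn lt_ij orbT.
pose w := invmx (Vandermonde p a) *m (\col_(i < p) f i).
exists (fun k => w k 0); pose h n := f n - \sum_k w k 0 * s`_k ^+ n.
suff h0 n : (n < D)%N -> h n = 0.
  by move=> n /h0/eqP; rewrite subr_eq0 => /eqP.
elim/ltn_ind: n => n IHn ltnD; have [lt_np|le_pn] := ltnP n p.
  have /matrixP/(_ (Ordinal lt_np) 0) : Vandermonde p a *m w = \col_(i < p) f i.
    by rewrite mulKVmx.
  rewrite !mxE /h => <-; apply/eqP; rewrite subr_eq0; apply/eqP.
  by apply: eq_bigr => k _; rewrite !mxE mulrC.
have rec_h : \sum_(i < p.+1) P`_i * h (i + (n - p))%N = 0.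
  rewrite (eq_bigr (fun i : 'I_p.+1 => P`_i * f (i + (n - p))%N -
     \sum_k w k 0 * s`_k ^+ (n - p) * (P`_i * s`_k ^+ i))); last first.
    move=> i _; rewrite mulrBr mulr_sumr; congr (_ - _).
    by apply: eq_bigr => k _; rewrite exprD; ring.
  rewrite sumrB rec_f ?subnK // exchange_big big1 ?subrr //= => k _.
  rewrite -mulr_sumr -horner_coef_wide ?sP //.
  have /eqP-> : root P s`_k by apply: (allP rootP); rewrite mem_nth.
  by rewrite mulr0.
move: rec_h; rewrite big_ord_recr big1 /= => [|i _]; last first.
  rewrite IHn ?mulr0 //; first by have := ltn_ord i; lia.
  by have := ltn_ord i; lia.
rewrite add0r subnKC // => /eqP; rewrite mulf_eq0 => /orP[|/eqP //].
have -> : P`_p = lead_coef P by rewrite lead_coefE sP.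
by rewrite lead_coef_eq0 -size_poly_eq0 sP.
Qed.

Lemma apolar_power_sums (K : closedFieldType) (d : nat) (f : nat -> K)
    (m : nat) (P : {poly K}) :
  separable_poly P -> (m <= size P <= m.+1)%N -> apolar d f m P ->
  power_sums d f m.
Proof.
move=> sepP sizeP apP; have P0 := separable_poly_neq0 sepP.
have [s sE] := closed_field_poly_normal P.
have lP0 : lead_coef P != 0 by rewrite lead_coef_eq0.
have sP : size P = (size s).+1 by rewrite sE size_scale // size_prod_XsubC.
have rP : all (root P) s.
  by apply/allP => z zs; rewrite sE rootZ // root_prod_XsubC.
have us : uniq s.
  rewrite -separable_prod_XsubC; apply: dvdp_separable sepP.
  by rewrite sE dvdpZr.
have [ms|ms] : m = size s \/ m = (size s).+1 by lia.
  have [k|c cE] := @apolar_interpolation _ d.+1 f s P us sP rP.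
    by rewrite ltnS -ms; exact: apP.
  rewrite ms; exists c, (fun k => s`_k), (fun=> 1) => n le_nd; rewrite cE //.
  by apply: eq_bigr => k _; rewrite expr1n mulr1.
have [k lt_kd|c cE] := @apolar_interpolation _ d f s P us sP rP.
  move: (apP k); rewrite ms addnS => /(_ lt_kd).
  by rewrite big_ord_recr /= nth_default ?sP // mul0r addr0.
(* The root at infinity becomes the node [(1 : 0)]. It contributes only to the moment of index [d],
   as [0 ^+ (d - n)] is nonzero only there, and its weight corrects that moment. *)
rewrite ms; pose c' (k : 'I_(size s).+1) :=
  if unlift ord_max k is Some k' then c k'
  else f d - \sum_i c i * s`_i ^+ d.
exists c', (fun k => if (k < size s)%N then s`_k else 1).
exists (fun k => (k < size s)%:R) => n le_nd.
rewrite big_ord_recr /= /c' unlift_none ltnn expr1n mul1r expr0n.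
under eq_bigr => k _.
  have -> : widen_ord (leqnSn (size s)) k = lift ord_max k.
    by apply: ord_inj; rewrite lift_max.
  by rewrite liftK ltn_ord expr1n mulr1 over.
rewrite subn_eq0; have [lt_nd|le_dn] := ltnP n d.
  by rewrite mulr0 addr0 cE.
have -> : n = d by lia.
by rewrite mulr1 addrC subrK.
Qed.

(** * From Waring decompositions to power sums *)

Lemma linear_form2 (K : nzRingType) (L : {mpoly K[2]}) :
  L \is 1.-homog ->
  L = L@_U_(0 : 'I_2) *: 'X_(0 : 'I_2) + L@_U_(1 : 'I_2) *: 'X_(1 : 'I_2).
Proof.
move=> homL; apply/mpolyP => m; rewrite mcoeffD !mcoeffZ !mcoeffX.
have [m1|m1] := eqVneq (mdeg m) 1%N; last first.
  have neq_Um i : (U_(i)%MM == m) = false.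
    by apply: contra_neqF m1 => /eqP <-; rewrite mdeg1.
  by rewrite (dhomog_nemf_coeff homL m1) !neq_Um !mulr0 addr0.
have /eqP/mdeg1P[i /eqP ->] := m1.
have [->|->] : i = 0 \/ i = 1.
  by case: i => [[|[|]]] // lti; [left|right]; apply: val_inj.
  rewrite eqxx mulr1 eq_mnm1 /= mulr0 addr0 //.
by rewrite eqxx mulr1 eq_mnm1 /= mulr0 add0r.
Qed.

Definition mnm2 (n k : nat) : 'X_{1.. 2} :=
  (U_((0 : 'I_2)%R) *+ n + U_((1 : 'I_2)%R) *+ k)%MM.

Lemma mcoeff_binary_monomial (K : nzRingType) (n k n' k' : nat) :
  (('X_(0 : 'I_2) ^+ n * 'X_(1 : 'I_2) ^+ k : {mpoly K[2]})@_(mnm2 n' k')) =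
  ((n == n') && (k == k'))%:R.
Proof.
rewrite !mpolyXn -mpolyXD mcoeffX; congr (nat_of_bool _)%:R.
apply/eqP/andP => [/mnmP E|[/eqP -> /eqP ->] //].
move: (E (0 : 'I_2)%R) (E (1 : 'I_2)%R); rewrite !mnmDE !mulmnE !mnmE /= .
by rewrite !mul1n !mul0n !addn0 !add0n => -> ->.
Qed.

Lemma linear_form_pow (K : comNzRingType) (u v : K) (d : nat) :
  (u *: 'X_(0 : 'I_2) + v *: 'X_(1 : 'I_2) : {mpoly K[2]}) ^+ d =
  \sum_(n < d.+1) (u ^+ n * v ^+ (d - n) *+ 'C(d, n)) *:
     ('X_(0 : 'I_2) ^+ n * 'X_(1 : 'I_2) ^+ (d - n)).
Proof.
rewrite addrC exprDn; apply: eq_bigr => n _.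
rewrite !exprZn -scalerAl -scalerAr scalerA scalerMnl mulrC.
by rewrite [_ * 'X_1 ^+ _]mulrC.
Qed.

(** Comparison of the coefficients of [x^n y^(d - n)] after binomial expansion; ['C(d, n)] cancels
    in characteristic zero. *)
Lemma waring_power_sums (R : realType) (d : nat) (f : nat -> R[i]) (m : nat) :
  waring_decomposable d (\sum_(n < d.+1) (f n *+ 'C(d, n)) *:
    ('X_(0 : 'I_2) ^+ n * 'X_(1 : 'I_2) ^+ (d - n))) m <->
  power_sums d f m.
Proof.
split=> [[c [L [homL FE]]]|[c [u [v fE]]]]; last first.
  exists c, (fun k => u k *: 'X_(0 : 'I_2) + v k *: 'X_(1 : 'I_2)).
  split=> [k|]; first by apply: rpredD; rewrite dhomogZ // dhomogX /= mdeg1.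
  transitivity (\sum_(k < m) \sum_(n < d.+1)
      (c k * (u k ^+ n * v k ^+ (d - n)) *+ 'C(d, n)) *:
      ('X_(0 : 'I_2) ^+ n * 'X_(1 : 'I_2) ^+ (d - n)) : {mpoly R[i][2]}).
    rewrite exchange_big; apply: eq_bigr => n _ /=.
    have le_nd : (n <= d)%N by rewrite -ltnS.
    by rewrite (fE n le_nd) -sumrMnl scaler_suml.
  apply: eq_bigr => k _; rewrite linear_form_pow scaler_sumr.
  by apply: eq_bigr => n _; rewrite scalerA mulrnAr.
exists c, (fun k => (L k)@_U_(0 : 'I_2)), (fun k => (L k)@_U_(1 : 'I_2)).
move=> n le_nd.
have coefE (g : nat -> R[i]) : (\sum_(i < d.+1) g i *:
      ('X_(0 : 'I_2) ^+ i * 'X_(1 : 'I_2) ^+ (d - i)))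
    @_(mnm2 n (d - n)) = g n.
  rewrite raddf_sum (bigD1 (Ordinal (le_nd : n < d.+1)%N)) //=.
  rewrite mcoeffZ mcoeff_binary_monomial !eqxx mulr1 big1 ?addr0 // => i ni.
  rewrite mcoeffZ mcoeff_binary_monomial.
  by move: ni; rewrite -val_eqE /= => /negPf ->; rewrite mulr0.
have := congr1 (mcoeff (mnm2 n (d - n))) FE.
rewrite (coefE (fun n => f n *+ 'C(d, n))) raddf_sum /=.
under eq_bigr => k _.
  rewrite mcoeffZ {1}(linear_form2 (homL k)) linear_form_pow.
  rewrite (coefE (fun n => _ ^+ n * _ ^+ (d - n) *+ 'C(d, n))) mulrnAr; over.
rewrite sumrMnl; apply: Num.Theory.pmulrnI.
by rewrite bin_gt0.
Qed.

(** * Separable polynomials *)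

Lemma separable_simple_root (K : closedFieldType) (P : {poly K}) :
  (forall z, root P z -> P^`().[z] != 0) -> separable_poly P.
Proof. by rewrite unlock; exact: Pdiv.ClosedField.root_coprimep. Qed.

Lemma exists_notin (K : numFieldType) (s : seq K) : exists t, t \notin s.
Proof.
pose u := [seq n%:R : K | n <- iota 0 (size s).+1].
have [/allP us|/allPn[t _ ts]] := boolP (all (mem s) u); last by exists t.
have u_uniq : uniq u.
  rewrite map_inj_uniq ?iota_uniq // => m n /eqP.
  by rewrite Num.Theory.eqr_nat => /eqP.
by have := uniq_leq_size u_uniq us; rewrite size_map size_iota ltnn.
Qed.

(* A repeated root [z] of [P + t X^m] is nonzero and a root of [m P - X P'],
   a polynomial independent of [t]; and [z] determines [t]. *)
Lemma separable_generic (K : numClosedFieldType) (P : {poly K}) (m : nat) :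
  P`_0 != 0 -> (0 < m)%N ->
  exists t, t != 0 /\ separable_poly (P + t *: 'X^m).
Proof.
move=> P0 m_gt0; pose Q := m%:R *: P - 'X * P^`().
have Q0 : Q != 0.
  apply: contraNneq P0 => /(congr1 (coefp 0)) /eqP.
  rewrite /= coefB coefZ coefXM coef0 subr0 mulf_eq0.
  by rewrite Num.Theory.pnatr_eq0 eqn0Ngt m_gt0.
have [s QE] := closed_field_poly_normal Q.
(* The finitely many excluded values are 0 and those for which a root of [Q] could be a root of
   [P + t *: 'X^m]. *)
have [t] := exists_notin (0 :: [seq - P.[z] / z ^+ m | z <- s]).
rewrite inE negb_or => /andP[t0 ts]; exists t; split=> //.
apply: separable_simple_root => z; rewrite /root !hornerE => /eqP Pz.
rewrite derivD derivZ derivXn !hornerE hornerMn !hornerE.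
apply: contraNneq ts => dPz.
have z0 : z != 0.
  apply: contraNneq P0 => z0; move: Pz.
  by rewrite z0 expr0n eqn0Ngt m_gt0 mulr0 addr0 horner_coef0 => ->.
have zs : z \in s.
  rewrite -root_prod_XsubC -(rootZ _ _ (a := lead_coef Q)) ?lead_coef_eq0 //.
  rewrite -QE /root /Q !hornerE.
  have -> : P.[z] = - (t * z ^+ m) by apply/eqP; rewrite -addr_eq0 Pz.
  have -> : P^`().[z] = - (t * (z ^+ m.-1 *+ m)).
    by apply/eqP; rewrite -addr_eq0 dPz.
  have -> : z ^+ m = z * z ^+ m.-1 by rewrite -exprS prednK.
  by rewrite -mulr_natl; apply/eqP; ring.
apply/mapP; exists z => //.
have -> : P.[z] = - (t * z ^+ m) by apply/eqP; rewrite -addr_eq0 Pz.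
by rewrite opprK mulfK // expf_neq0.
Qed.

(** For [c = - (A / B)] the coefficients solve [A P_i + B P_(i + alpha) = 0] up to the truncation,
    with support on multiples of [alpha]. *)
Definition geom_poly (K : fieldType) (c : K) (alpha N : nat) : {poly K} :=
  \sum_(k < N) (c *: 'X^alpha) ^+ k.

Lemma coef_geom_poly (K : fieldType) (c : K) (alpha N i : nat) :
  (0 < alpha)%N ->
  (geom_poly c alpha N)`_i =
  if (alpha %| i)%N && (i < alpha * N)%N then c ^+ (i %/ alpha) else 0.
Proof.
move=> al_gt0; rewrite /geom_poly coef_sum.
under eq_bigr do rewrite exprZn -exprM coefZ coefXn.
case: ifP => [/andP[/dvdnP[k ->]]|ni].
  rewrite mulnC ltn_pmul2l // mulKn // => lt_kN.
  rewrite (bigD1 (Ordinal lt_kN)) //= eqxx mulr1 big1 ?addr0 // => l.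
  rewrite -val_eqE /= eqn_pmul2l // eq_sym => /negPf ->.
  by rewrite mulr0.
apply: big1 => k _; case: eqP => [iE|]; last by rewrite mulr0.
by move: ni; rewrite iE dvdn_mulr // ltn_pmul2l // ltn_ord.
Qed.

Lemma size_geom_poly (K : fieldType) (c : K) (alpha N : nat) :
  c != 0 -> (0 < alpha)%N -> size (geom_poly c alpha N.+1) = (alpha * N).+1.
Proof.
move=> c0 al_gt0; rewrite /geom_poly big_ord_recr /= -/(geom_poly _ _ _).
have sz : size ((c *: 'X^alpha) ^+ N : {poly K}) = (alpha * N).+1.
  by rewrite exprZn -exprM size_scale ?expf_neq0 // size_polyXn.
rewrite addrC size_polyDl sz // ltnS; apply/leq_sizeP => i le_i.
by rewrite coef_geom_poly // ltnNge le_i andbF.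
Qed.

(* [geom_poly] divides [(c X^alpha)^N - 1]. *)
Lemma separable_geom_poly (K : numClosedFieldType) (c : K) (alpha N : nat) :
  c != 0 -> (0 < alpha)%N -> (0 < N)%N -> separable_poly (geom_poly c alpha N).
Proof.
move=> c0 al_gt0 N_gt0.
suff: separable_poly ((c *: 'X^alpha) ^+ N - 1 : {poly K}).
  by apply: dvdp_separable; rewrite subrX1 dvdp_mulIr.
rewrite exprZn -exprM; apply: separable_simple_root => z.
have M_gt0 : (0 < alpha * N)%N by rewrite muln_gt0 al_gt0.
rewrite /root !hornerE subr_eq0 => /eqP zM.
rewrite derivB derivZ derivXn derivC subr0 !hornerE hornerMn !hornerE.
have z0 : z != 0.
  apply: contra_eq_neq zM => ->.
  by rewrite expr0n eqn0Ngt M_gt0 mulr0 eq_sym oner_eq0.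
by rewrite -mulr_natl !mulf_neq0 ?expf_neq0 // Num.Theory.pnatr_eq0 -lt0n.
Qed.

(** * Apolarity equations of a binomial *)

Definition binomial_moments (K : fieldType) (A B : K) (r alpha n : nat) : K :=
  A *+ (n == r) + B *+ (n == r + alpha)%N.

(* The equations [sum_i P_i f_(i + k) = 0] for the moments [A] at [r] and [B] at
   [r + alpha], written with [i = r - k], respectively [t = r + alpha - k]. *)
Definition binomial_apolar (K : fieldType) (A B : K) (r s alpha n : nat)
    (P : {poly K}) : Prop :=
  [/\ separable_poly P, (n <= size P <= n.+1)%N,
    forall i, (i <= r)%N -> (n <= s + alpha + i)%N ->
      A * P`_i + B * P`_(i + alpha) = 0 &
    forall t, (t < alpha)%N -> (n <= s + t)%N -> P`_t = 0].

(** The factor [(k <= t)%N] guards against truncated subtraction; when [t - k] exceeds [n], the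
    coefficient is zero by default. *)
Lemma sum_coef_delta (K : fieldType) (P : {poly K}) (A : K) (n k t : nat) :
  (size P <= n.+1)%N ->
  \sum_(i < n.+1) P`_i * (A *+ (i + k == t)%N) = A * (P`_(t - k) *+ (k <= t)%N).
Proof.
move=> sP; have [le_kt|lt_tk] := leqP k t; last first.
  rewrite mulr0n mulr0 big1 // => i _.
  by rewrite (_ : (_ == t)%N = false) ?mulr0 //; lia.
have [lt_n|le_n] := ltnP (t - k) n.+1.
  rewrite (bigD1 (Ordinal lt_n)) //= subnK // eqxx !mulr1n mulrC.
  rewrite big1 ?addr0 // => i; rewrite -val_eqE /= => ni.
  by rewrite (_ : (_ == t)%N = false) ?mulr0 //; lia.
rewrite (nth_default _ (leq_trans sP le_n)) mul0rn mulr0 big1 // => i _.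
rewrite (_ : (_ == t)%N = false) ?mulr0 //.
by have := ltn_ord i; lia.
Qed.

(** The equation of index [k] involves both moments for [k <= r], only [B] for [r < k <= r + alpha],
    and is void beyond; [B != 0] is cancelled in the middle range. *)
Lemma apolar_binomialP (K : fieldType) (A B : K) (r s alpha n : nat)
    (P : {poly K}) :
  B != 0 -> separable_poly P -> (n <= size P <= n.+1)%N ->
  apolar (r + s + alpha) (binomial_moments A B r alpha) n P <->
  binomial_apolar A B r s alpha n P.
Proof.
move=> B0 sepP sP; have /andP[_ sP1] := sP.
have sumE k : \sum_(i < n.+1) P`_i * binomial_moments A B r alpha (i + k) =
    A * (P`_(r - k) *+ (k <= r)%N) +
    B * (P`_(r + alpha - k) *+ (k <= r + alpha)%N).
  rewrite -!(@sum_coef_delta _ _ _ n) // -big_split /=.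
  by apply: eq_bigr => i _; rewrite -mulrDr.
split=> [apP|[_ _ E1 E2] k le_kd]; last first.
  rewrite sumE; have [le_kr|lt_rk] := leqP k r.
    rewrite (_ : (k <= r + alpha)%N) ?mulr1n; last by lia.
    by rewrite -addnBAC // E1 //; lia.
  rewrite mulr0n mulr0 add0r.
  have [le_k|_] := leqP k (r + alpha); last by rewrite mulr0n mulr0.
  by rewrite E2 ?mul0rn ?mulr0 //; lia.
split=> // [i le_ir le_n|t lt_t le_n].
  have /apP : (r - i + n <= r + s + alpha)%N by lia.
  rewrite sumE.
  have -> : (r - i <= r)%N by lia.
  have -> : (r - i <= r + alpha)%N by lia.
  have -> : (r - (r - i) = i)%N by lia.
  by have -> : (r + alpha - (r - i) = i + alpha)%N by lia.
have /eqP : B * P`_t = 0.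
  have /apP : (r + alpha - t + n <= r + s + alpha)%N by lia.
  rewrite sumE.
  have -> : (r + alpha - t <= r)%N = false by lia.
  have -> : (r + alpha - t <= r + alpha)%N by lia.
  have -> : (r + alpha - (r + alpha - t) = t)%N by lia.
  by rewrite mulr0n mulr0 add0r.
by rewrite mulf_eq0 (negPf B0) => /eqP.
Qed.

(** Otherwise 0 is a common root of [P] and its derivative. *)
Lemma separable_coef01 (K : fieldType) (P : {poly K}) :
  separable_poly P -> P`_0 = 0 -> P`_1 <> 0.
Proof.
rewrite unlock => copP P0 P1.
have /eqP[] : (P^`()).[0] != 0.
  by apply: coprimep_root copP _; rewrite /root horner_coef0 P0.
by rewrite horner_coef0 coef_deriv P1 mul0rn.
Qed.

(** * Lower bounds on the degree of an apolar form *)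

Section LowerBound.

Variables (K : fieldType) (A B : K) (r s alpha q j n : nat) (P : {poly K}).
Hypotheses (A0 : A != 0) (B0 : B != 0).
Hypotheses (le_rs : (r <= s)%N) (al_gt0 : (0 < alpha)%N).
Hypotheses (r_def : r = (q * alpha + j)%N) (j_lt : (j < alpha)%N).
Hypothesis apP : binomial_apolar A B r s alpha n P.

(** As [B != 0], vanishing at [t] climbs through the residue class of [t] modulo [alpha]. *)
Lemma coef_chain_up t k : (t < alpha)%N -> (n <= s + t)%N ->
  (t + k * alpha <= r + alpha)%N -> P`_(t + k * alpha) = 0.
Proof.
case: apP => _ _ E1 E2 lt_t le_n; elim: k => [|k IHk] le_r.
  by rewrite addn0 E2.
rewrite mulSnr in le_r *; have /E1 : (t + k * alpha <= r)%N by lia.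
rewrite IHk ?mulr0 ?add0r -?addnA; last by lia.
move=> E; have /eqP : B * P`_(t + (k * alpha + alpha)) = 0 by apply: E; lia.
by rewrite mulf_eq0 (negPf B0) => /eqP.
Qed.

(** The index [i + alpha] lies beyond the degree bound, so its coefficient is zero; as [A != 0],
    vanishing descends in steps of [alpha]. *)
Lemma coef_chain_down i k : (i <= r)%N -> (n < i + alpha)%N ->
  (k * alpha <= i)%N -> P`_(i - k * alpha) = 0.
Proof.
case: apP => _ /andP[_ sP] E1 _ le_ir lt_n.
have P0 l : (l <= r)%N -> (n <= s + alpha + l)%N ->
    P`_(l + alpha) = 0 -> P`_l = 0.
  move=> le_l le_n Pl; have := E1 l le_l le_n.
  by rewrite Pl mulr0 addr0 => /eqP; rewrite mulf_eq0 (negPf A0) => /eqP.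
elim: k => [|k IHk] le_i.
  rewrite mul0n subn0; apply: P0; [lia | lia |].
  by rewrite nth_default // (leq_trans sP).
rewrite mulSnr in le_i *; apply: P0; [lia | lia |].
have -> : (i - (k * alpha + alpha) + alpha = i - k * alpha)%N by lia.
by apply: IHk; lia.
Qed.

Lemma coef01_neq0 : P`_0 = 0 -> P`_1 = 0 -> False.
Proof. by case: apP => sepP _ _ _; exact: separable_coef01. Qed.

(** The bounds on [size P] allow at most a simple root at infinity. *)
Lemma coef_top_neq0 : (0 < n)%N -> P`_n = 0 -> P`_n.-1 = 0 -> False.
Proof.
case: apP => sepP sP _ _ n_gt0 Pn Pn1; have P0 := separable_poly_neq0 sepP.
have /eqP[] : lead_coef P != 0 by rewrite lead_coef_eq0.
by rewrite lead_coefE; have [->|->] : size P = n \/ size P = n.+1 by lia.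
Qed.

(** If [n <= s], all [P_t] with [t < alpha] vanish, so 0 is a double root; for [alpha = 1] the index
    1 is reached from 0 by one step up. *)
Lemma lower_bound_general : (s < n)%N.
Proof.
rewrite ltnNge; apply/negP => le_ns; apply: coef01_neq0.
  by apply: (@coef_chain_up 0 0); lia.
have [al1|al1] : alpha = 1%N \/ (1 < alpha)%N by lia.
  by have := @coef_chain_up 0 1; rewrite al1; apply; lia.
by apply: (@coef_chain_up 1 0); lia.
Qed.

(** If [n <= r + alpha], then [n] and [n - 1] are both reached by [q + 1] steps up from indices
    below [alpha] where [P] vanishes, because [(q + 1) alpha < s]. Infinity would be a double
    root. *)
Lemma lower_bound_j_large : (r + alpha < s + j)%N -> (r + alpha < n)%N.
Proof.
move=> lt_j; rewrite ltnNge; apply/negP => le_n.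
have lt_sn := lower_bound_general.
have lt_s : (q.+1 * alpha < s)%N by rewrite mulSnr; lia.
have le_r : (r < q.+1 * alpha + j.+1)%N by rewrite mulSnr; lia.
apply: coef_top_neq0; first by lia.
  rewrite (_ : n = n - q.+1 * alpha + q.+1 * alpha)%N; last by lia.
  by apply: coef_chain_up; lia.
rewrite (_ : n.-1 = n.-1 - q.+1 * alpha + q.+1 * alpha)%N; last by lia.
by apply: coef_chain_up; lia.
Qed.

Lemma coef0_eq0 : (n < q.+1 * alpha)%N -> P`_0 = 0.
Proof.
rewrite mulSnr => lt_n; rewrite -(subnn (q * alpha)%N).
by apply: coef_chain_down; lia.
Qed.

(** For smaller [n], descent gives [P_0 = 0]. If [j > 0], it also starts at [q alpha + 1 <= r] and
    gives [P_1 = 0]; if [j = 0] and [r < s], climbing [q] steps makes infinity a double root. *)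
Lemma lower_bound_j_small :
  ~~ [&& j == 0%N, r == s & (1 < alpha)%N] -> (q.+1 * alpha <= n)%N.
Proof.
move=> nspecial; rewrite leqNgt; apply/negP => lt_n.
have lt_sn := lower_bound_general; have P0 := coef0_eq0 lt_n.
rewrite mulSnr in lt_n; have [j_gt0|j0] : (0 < j)%N \/ j = 0%N by lia.
  apply: coef01_neq0 => //.
  rewrite (_ : 1 = (q * alpha).+1 - q * alpha)%N; last by lia.
  by apply: coef_chain_down; lia.
have [lt_rs|eq_rs] : (r < s)%N \/ r = s by lia.
  apply: coef_top_neq0; first by lia.
    rewrite (_ : n = n - q * alpha + q * alpha)%N; last by lia.
    by apply: coef_chain_up; lia.
  rewrite (_ : n.-1 = n.-1 - q * alpha + q * alpha)%N; last by lia.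
  by apply: coef_chain_up; lia.
(* What remains is [alpha = 1] and [s = r = q], where [s < n] contradicts [n < q + 1]. *)
by move: nspecial; rewrite j0 eq_rs !eqxx /=; lia.
Qed.

(** At [n = s + 1], descent gives [P_0 = 0], and [P_1 = 0] is the equation at [t = 1]. *)
Lemma lower_bound_special :
  j = 0%N -> r = s -> (1 < alpha)%N -> (s.+1 < n)%N.
Proof.
move=> j0 eq_rs al_gt1; have lt_sn := lower_bound_general.
rewrite ltn_neqAle lt_sn andbT; apply/eqP => n_def; apply: coef01_neq0.
  by apply: coef0_eq0; rewrite mulSnr; lia.
by apply: (@coef_chain_up 1 0); lia.
Qed.

End LowerBound.

(** * Construction of separable apolar forms *)

Section UpperBound.

Variables (K : numClosedFieldType) (A B : K) (r s alpha q j : nat).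
Hypotheses (A0 : A != 0) (B0 : B != 0).
Hypotheses (le_rs : (r <= s)%N) (al_gt0 : (0 < alpha)%N).
Hypotheses (r_def : r = (q * alpha + j)%N) (j_lt : (j < alpha)%N).

Let c := - (A / B).

Let c0 : c != 0.
Proof. by rewrite oppr_eq0 mulf_neq0 ?invr_eq0. Qed.

Lemma geom_poly_rec N i : (i < alpha * N)%N ->
  A * (geom_poly c alpha N.+1)`_i + B * (geom_poly c alpha N.+1)`_(i + alpha) = 0.
Proof.
move=> lt_i; rewrite !coef_geom_poly // dvdn_addl // mulnSr ltn_add2r lt_i.
rewrite ltn_addr // !andbT; case: ifP => _; last by rewrite !mulr0 addr0.
rewrite divnDr // divnn al_gt0 addn1 exprS /c; field.
by rewrite B0.
Qed.

Lemma geom_poly_low N t : (0 < t < alpha)%N -> (geom_poly c alpha N)`_t = 0.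
Proof.
move=> /andP[t_gt0 lt_t]; rewrite coef_geom_poly // gtnNdvd //.
Qed.

(** The geometric sum has degree [(q + 1) alpha]; the larger value of [n] adds a simple root at
    infinity. By [s < n], only coefficients with [t > 0] are required to vanish. *)
Lemma upper_bound_geom n : (s < n)%N ->
  (q.+1 * alpha <= n <= q.+1 * alpha + 1)%N ->
  exists P, binomial_apolar A B r s alpha n P.
Proof.
move=> lt_sn n_bounds; exists (geom_poly c alpha q.+2); split.
- exact: separable_geom_poly.
- by rewrite size_geom_poly // mulnC; lia.
- move=> i le_ir _; apply: geom_poly_rec.
  by rewrite mulnC mulSnr; lia.
- by move=> t lt_t le_n; apply: geom_poly_low; lia.
Qed.

(** Adding [t X^n] raises the degree to [n], and [r + alpha < n] keeps the new coefficient out of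
    all the equations. *)
Lemma upper_bound_generic n : (s < n)%N -> (r + alpha < n)%N ->
  exists P, binomial_apolar A B r s alpha n P.
Proof.
move=> lt_sn lt_rn.
have lt_qn : (alpha * q.+1 < n)%N by rewrite mulnC mulSnr; lia.
have [||t [t0 sepP]] := @separable_generic _ (geom_poly c alpha q.+2) n.
- by rewrite coef_geom_poly // dvdn0 muln_gt0 al_gt0 div0n oner_eq0.
- by lia.
exists (geom_poly c alpha q.+2 + t *: 'X^n); split=> //.
- rewrite addrC size_polyDl size_scale // size_polyXn ?leqnSn ?leqnn //.
  by rewrite size_geom_poly.
- move=> i le_ir _; rewrite !coefD !coefZ !coefXn.
  have -> : (i == n) = false by lia.
  have -> : (i + alpha == n)%N = false by lia.
  rewrite !mulr0 !addr0; apply: geom_poly_rec.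
  by rewrite mulnC mulSnr; lia.
move=> i lt_i le_n; rewrite coefD coefZ coefXn.
have -> : (i == n) = false by lia.
rewrite mulr0 addr0.
by apply: geom_poly_low; lia.
Qed.

(** Here [s = q alpha], so the witness has degree [s + 1]: besides the geometric part, the form has
    simple roots at 0 and at infinity. *)
Lemma upper_bound_special : j = 0%N -> r = s -> (1 < alpha)%N ->
  exists P, binomial_apolar A B r s alpha (s + 2) P.
Proof.
move=> j0 eq_rs al_gt1; exists (geom_poly c alpha q.+1 * 'X).
have G0 : geom_poly c alpha q.+1 != 0.
  by rewrite -size_poly_eq0 size_geom_poly.
split.
- rewrite separable_mul separable_geom_poly // coprimepX /root horner_coef0.
  rewrite coef_geom_poly // dvdn0 muln_gt0 al_gt0 div0n oner_eq0 andbT /=.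
  by rewrite unlock derivX coprimep1.
- by rewrite size_mulX // size_geom_poly // mulnC; lia.
- move=> [|i] le_ir _; rewrite !coefMX /=.
    (* The coefficient [P_alpha] is that of index [alpha - 1] in the geometric sum, zero as
       [alpha > 1]. *)
    rewrite add0n (_ : (alpha == 0)%N = false) ?geom_poly_low ?mulr0 ?addr0 //; lia.
  by rewrite geom_poly_rec // mulnC; lia.
- move=> t lt_t le_n; rewrite coefMX; case: eqP => // t0.
  by rewrite geom_poly_low //; lia.
Qed.

End UpperBound.

(** * The rank of the binomial form *)

Lemma binomial_form_moments (R : realType) (a b : R[i]) (r s alpha : nat) :
  let d := (r + s + alpha)%N in
  binomial_form a b r s alpha =
  \sum_(n < d.+1)
    (binomial_moments (a / 'C(d, r)%:R) (b / 'C(d, r + alpha)%:R) r alpha n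
       *+ 'C(d, n)) *:
    ('X_(0 : 'I_2) ^+ n * 'X_(1 : 'I_2) ^+ (d - n)).
Proof.
move=> d; have single (A : R[i]) k : (k <= d)%N ->
    \sum_(n < d.+1) ((A / 'C(d, k)%:R) *+ (n == k :> nat) *+ 'C(d, n)) *:
      ('X_(0 : 'I_2) ^+ n * 'X_(1 : 'I_2) ^+ (d - n)) =
    A *: ('X_(0 : 'I_2) ^+ k * 'X_(1 : 'I_2) ^+ (d - k)) :> {mpoly R[i][2]}.
  move=> le_kd; rewrite (bigD1 (Ordinal (le_kd : k < d.+1)%N)) //= eqxx mulr1n.
  rewrite -[_ *+ 'C(d, k)]mulr_natr divfK; last first.
    by rewrite Num.Theory.pnatr_eq0 -lt0n bin_gt0.
  rewrite big1 ?addr0 // => i; rewrite -val_eqE /= => /negPf ->.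
  by rewrite mulr0n mul0rn scale0r.
rewrite /binomial_moments; under eq_bigr do rewrite mulrnDl scalerDl.
rewrite big_split /= !single /d; [|lia..].
rewrite /binomial_form; congr (_ *: (_ * _ ^+ _) + _ *: (_ * _ ^+ _)); lia.
Qed.

(** A decomposition into [m'] powers yields an apolar form of some degree [m <= m'], so the rank is
    the least degree of a separable apolar form. *)
Lemma binomial_form_rank (R : realType) (a b : R[i]) (r s alpha n : nat) :
  let d := (r + s + alpha)%N in
  let A := a / 'C(d, r)%:R in
  let B := b / 'C(d, r + alpha)%:R in
  B != 0 ->
  (exists P, binomial_apolar A B r s alpha n P) ->
  (forall m P, binomial_apolar A B r s alpha m P -> (n <= m)%N) ->
  is_waring_rank d (binomial_form a b r s alpha) n.
Proof.
move=> d A B B0 [P apP] min_n; rewrite /is_waring_rank binomial_form_moments.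
split=> [|m'].
  apply/waring_power_sums; have [sepP sP _ _] := apP.
  by apply: (apolar_power_sums sepP sP); apply/apolar_binomialP.
move/waring_power_sums/power_sums_apolar => [m [Q [le_m sQ sepQ apQ]]].
by apply: leq_trans le_m; apply: (min_n m Q); apply/apolar_binomialP.
Qed.

Theorem theorem3p1 (R : realType) (r s alpha : nat) (a b : R[i]) (q j : nat)
    (le_rs : (r <= s)%N) (alpha_ge1 : (1 <= alpha)%N) (ab_neq0 : a * b != 0)
    (r_def : r = (q * alpha + j)%N) (j_lt : (j < alpha)%N) :
  let F := binomial_form a b r s alpha in
  let d := (r + s + alpha)%N in
  let delta : int := r%:Z + alpha%:Z - s%:Z in
  (delta <= 0 -> is_waring_rank d F (s + 1)%N) /\
  (0 < delta ->
     is_waring_rank d F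
       (if [&& j == 0%N, r == s & (1 < alpha)%N] then (s + 2)%N
        else if j%:Z == delta then (s + 1)%N
        else if delta < j%:Z then (r + alpha + 1)%N
        else (r + alpha - j)%N)).
Proof.
move=> F d delta; move: ab_neq0; rewrite mulf_eq0 negb_or => /andP[a0 b0].
have A0 : a / 'C(d, r)%:R != 0.
  rewrite mulf_neq0 // invr_neq0 // Num.Theory.pnatr_eq0 -lt0n bin_gt0 /d; lia.
have B0 : b / 'C(d, r + alpha)%:R != 0.
  rewrite mulf_neq0 // invr_neq0 // Num.Theory.pnatr_eq0 -lt0n bin_gt0 /d; lia.
have lower := lower_bound_general A0 B0 le_rs alpha_ge1 r_def j_lt.
have lower_s m P : binomial_apolar (a / 'C(d, r)%:R) (b / 'C(d, r + alpha)%:R)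
    r s alpha m P -> (s + 1 <= m)%N.
  by rewrite addn1; exact: lower.
have qE : (q.+1 * alpha = r + alpha - j)%N by rewrite mulSnr; lia.
split=> [delta_le0|delta_gt0].
  (* Here [r + alpha <= s], so [n = s + 1] meets both bounds of the generic construction. *)
  apply: binomial_form_rank => //.
  by apply: (upper_bound_generic A0 B0 le_rs alpha_ge1 r_def j_lt); lia.
case: ifP => [/and3P[/eqP j0 /eqP eq_rs al_gt1]|/negbT nspecial].
  apply: binomial_form_rank => // [|m P apP].
    exact: (upper_bound_special A0 B0 le_rs alpha_ge1 r_def).
  rewrite addn2.
  exact: lower_bound_special A0 B0 le_rs alpha_ge1 r_def j_lt apP j0 eq_rs al_gt1.
case: eqP => [j_delta|j_ndelta].
  (* Now [s = (q + 1) alpha], so [s + 1] is the degree of the geometric sum plus a root at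
     infinity. *)
  apply: binomial_form_rank => //.
  by apply: (upper_bound_geom A0 B0 le_rs alpha_ge1 r_def j_lt); lia.
case: ifP => [lt_j|ge_j].
  apply: binomial_form_rank => // [|m P apP].
    by apply: (upper_bound_generic A0 B0 le_rs alpha_ge1 r_def j_lt); lia.
  rewrite addn1.
  by apply: lower_bound_j_large A0 B0 le_rs alpha_ge1 r_def j_lt apP _; lia.
(* Now [j < delta], that is [s < (q + 1) alpha]. *)
apply: binomial_form_rank => // [|m P apP].
  by apply: (upper_bound_geom A0 B0 le_rs alpha_ge1 r_def j_lt); lia.
rewrite -qE.
exact: lower_bound_j_small A0 B0 le_rs alpha_ge1 r_def j_lt apP nspecial.
Qed.
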